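(* For any $s,k\geq 1$, every connected component of the graph $G_{s,k}$ is isomorphic (as a graph) to the 1-skeleton of the permutohedron $P_k$.
   Context: For $s,k\ge 1$, $G_{s,k}$ is the graph whose vertices are the tuples $(i_0,\ldots,i_k)$ of integers with $0\le i_j\le s+j$ for $j=0,\ldots,k$ (the tuple represents the formal composite of coface maps $\partial^{i_k}_{s+k}\circ\cdots\circ\partial^{i_0}_s$). Its edges are the expanded coherers: for each vertex $(i_0,\ldots,i_k)$ and each $p\in\{0,\ldots,k-1\}$ with $i_p<i_{p+1}$ there is one edge joining $(i_0,\ldots,i_p,i_{p+1},\ldots,i_k)$ to $(i_0,\ldots,i_{p-1},i_{p+1}-1,i_p,i_{p+2},\ldots,i_k)$ (this edge represents $\tau^{s+p}_{i_p,i_{p+1}}:\partial^{i_{p+1}}_{s+p+1}\circ\partial^{i_p}_{s+p}\Rightarrow\partial^{i_p}_{s+p+1}\circ\partial^{i_{p+1}-1}_{s+p}$, whiskered by the remaining coface maps). The permutohedron $P_k$ is the convex hull in $\mathbb{R}^{k+1}$ of the points $(\sigma(1),\ldots,\sigma(k+1))$, $\sigma\in S_{k+1}$. Its 1-skeleton is the graph formed by its vertices and 1-dimensional faces. *)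

(* Defs.v *)
From Stdlib Require Import Relation_Operators.
From HB Require Import structures.
From mathcomp Require Import all_boot all_order all_algebra perm.
From mathcomp Require Import boolp classical_sets functions reals convex.

Set Implicit Arguments.
Unset Strict Implicit.
Unset Printing Implicit Defensive.

Import Order.TTheory GRing.Theory Num.Theory.
Local Open Scope classical_set_scope.
Local Open Scope ring_scope.

(* Undirected graphs whose edges are named, so that parallel edges would be
   counted separately.  Vertices and edges are carved out of ambient types, and
   [ends e] is the (one- or two-element) set of endpoints of [e]. *)
Record graph (V E : Type) := Graph {
  verts : set V;
  edges : set E;
  ends : E -> set V }.

Definition graph_iso (V E V' E' : Type) (G : graph V E) (H : graph V' E') :=
  exists (f : V -> V') (g : E -> E'),
    [/\ set_bij (verts G) (verts H) f,
        set_bij (edges G) (edges H) g &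
        forall e, edges G e -> ends H (g e) = f @` ends G e].

Definition adjacent (V E : Type) (G : graph V E) (u v : V) : Prop :=
  exists2 e, edges G e & ends G e = [set u; v].

Definition induced_subgraph (V E : Type) (G : graph V E) (A : set V) :
    graph V E :=
  {| verts := verts G `&` A;
     edges := [set e | edges G e /\ ends G e `<=` A];
     ends := ends G |}.

Definition component (V E : Type) (G : graph V E) (v : V) : graph V E :=
  induced_subgraph G [set u | clos_refl_trans V (adjacent G) v u].

(* Positions p and p + 1 in a tuple indexed by 0, ..., k, for p < k. *)
Definition pos0 (k : nat) (p : 'I_k) : 'I_k.+1 := widen_ord (leqnSn k) p.
Definition pos1 (k : nat) (p : 'I_k) : 'I_k.+1 := lift ord0 p.

(* Used only when [v (pos0 p) < v (pos1 p)], so the predecessor is not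
   truncated. *)
Definition coherer_target (k : nat) (v : {ffun 'I_k.+1 -> nat}) (p : 'I_k) :
    {ffun 'I_k.+1 -> nat} :=
  [ffun j => if j == pos0 p then (v (pos1 p)).-1
             else if j == pos1 p then v (pos0 p) else v j].

Definition coface_word (s k : nat) : set {ffun 'I_k.+1 -> nat} :=
  [set v | forall j : 'I_k.+1, (v j <= s + j)%N].
Arguments coface_word : clear implicits.

Definition coherer_graph (s k : nat) :
    graph {ffun 'I_k.+1 -> nat} ({ffun 'I_k.+1 -> nat} * 'I_k) :=
  {| verts := coface_word s k;
     edges := [set e | coface_word s k e.1 /\
                      (e.1 (pos0 e.2) < e.1 (pos1 e.2))%N];
     ends := fun e => [set e.1; coherer_target e.1 e.2] |}.

Definition convex_hull (R : realType) (E : vectType R) (A : set E) : set E :=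
  smallest (@convex_set R (convex_lmodType E)) A.

(* Faces are cut out by valid linear inequalities; [l = 0] gives the improper
   faces [P] and [set0]. *)
Definition face (R : realType) (E : vectType R) (P F : set E) : Prop :=
  exists (l : {scalar E}) (c : R),
    (forall x, P x -> l x <= c) /\ F = P `&` [set x | l x = c].

(* [F] is nonempty and its affine hull has dimension [d]: [U] is the direction
   of the affine hull [x0 + U]. *)
Definition has_affine_dim (R : realType) (E : vectType R) (F : set E)
    (d : nat) : Prop :=
  exists (x0 : E) (U : {vspace E}),
    [/\ F x0, \dim U = d, (forall x, F x -> x - x0 \in U) &
        forall W : {vspace E}, (forall x, F x -> x - x0 \in W) ->
          (U <= W)%VS].

Definition polytope_vertex (R : realType) (E : vectType R) (P : set E) : set E :=
  [set x | face P [set x]].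

Definition one_skeleton (R : realType) (E : vectType R) (P : set E) :
    graph E (set E) :=
  {| verts := polytope_vertex P;
     edges := [set F | face P F /\ has_affine_dim F 1%N];
     ends := fun F => F `&` polytope_vertex P |}.

(* Permutations act on ['I_k.+1 = {0, ..., k}], hence the successor. *)
Definition permutohedron (R : realType) (k : nat) : set 'rV[R]_k.+1 :=
  convex_hull (range (fun sigma : 'S_k.+1 => \row_j (sigma j).+1%:R)).
Arguments permutohedron : clear implicits.

(* Main.v *)
(* The composite of the cofaces of a word v omits k + 1 values, one for each
   position.  By the cosimplicial identity a coherer at p exchanges the values
   omitted at p and p + 1 and fixes the others, and its direction only records
   which of the two is larger.  So the component of v is the Cayley graph of
   S_{k+1} with respect to the adjacent transpositions.

   On the other side, the faces of the permutohedron are the hulls of the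
   permutations maximising a linear form.  The form given by s + t isolates the
   pair {s, t} when t exchanges two consecutive values of s.  Conversely an edge
   contains exactly two permutations s and t, because they lie on a sphere; some
   consecutive values p, p + 1 of s are in the opposite order in t, so the form
   has equal coefficients at their positions, hence exchanging these values in s
   also gives a maximiser, which must be t. *)

Require Import Defs.
From Stdlib Require Import Relation_Operators.
From HB Require Import structures.
From mathcomp Require Import all_boot all_order all_algebra fingroup perm.
From mathcomp Require Import zify lra ring.
From mathcomp Require Import boolp interval_inference classical_sets functions.
From mathcomp Require Import reals convex.

Set Implicit Arguments.
Unset Strict Implicit.
Unset Printing Implicit Defensive.

Import Order.TTheory GRing.Theory Num.Theory.
Local Open Scope classical_set_scope.
Local Open Scope ring_scope.

(** * Values omitted by a composite of cofaces *)

(* The value omitted by the composite of the cofaces [v 0], ..., [v n.-1] on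
   account of the coface at position [j < n]. *)
Fixpoint missed (v : nat -> nat) (n j : nat) : nat :=
  if n is m.+1 then
    if j == m then v m else bump (v m) (missed v m j)
  else 0%N.

Lemma missed_inj (v : nat -> nat) (n : nat) :
  {in gtn n &, injective (missed v n)}.
Proof.
elim: n => [|n IH] i j; rewrite !inE //= => lt_i lt_j.
case: (eqVneq i n) => [->|ni]; case: (eqVneq j n) => [->|nj] //.
- by move/eqP; rewrite (negPf (neq_bump _ _)).
- by move/eqP; rewrite eq_sym (negPf (neq_bump _ _)).
- by move/(can_inj (bumpK _))/IH; apply; rewrite inE; lia.
Qed.

Lemma missed_recover (v w : nat -> nat) (n : nat) :
  (forall j, (j < n)%N -> missed v n j = missed w n j) ->
  forall j, (j < n)%N -> v j = w j.
Proof.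
elim: n => [|n IH] //= eqm.
have eqn : v n = w n by have := eqm n (ltnSn n); rewrite eqxx.
have {}IH : forall j, (j < n)%N -> v j = w j.
  apply: IH => j lt_j; have := eqm j (ltnW lt_j).
  by rewrite (ltn_eqF lt_j) eqn => /(can_inj (bumpK _)).
by move=> j; rewrite ltnS leq_eqVlt => /predU1P[->|/IH].
Qed.

(** Cofaces after position [p.+1] are monotone, so only the one at [p.+1] matters: [bump b a < b]
    holds exactly when [a < b]. *)
Lemma missed_ltn (v : nat -> nat) (n p : nat) : (p.+1 < n)%N ->
  (missed v n p < missed v n p.+1)%N = (v p < v p.+1)%N.
Proof.
elim: n => [|n IH] //; rewrite ltnS leq_eqVlt => /predU1P[<-|lt_pn] /=.
  by rewrite eqxx (ltn_eqF (ltnSn p)); case: p {IH} => [|p] /=; rewrite ?eqxx /bump; lia.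
rewrite (ltn_eqF lt_pn) (ltn_eqF (ltnW lt_pn)) ltnNge leq_bump2 -ltnNge.
exact: IH.
Qed.

(* The cosimplicial identity. *)
Lemma bump_bump (a b x : nat) : (a < b)%N ->
  bump b (bump a x) = bump a (bump b.-1 x).
Proof.
rewrite /bump => lt_ab.
by case: (leqP a x) => ax; case: (leqP b.-1 x) => bx; rewrite ?add0n ?add1n;
  case: leqP => ?; case: leqP => ?; lia.
Qed.

Definition swapn (p j : nat) : nat :=
  if j == p then p.+1 else if j == p.+1 then p else j.

(** Cofaces after [p.+1] are the same in both words, so induction reduces to [n = p.+2]. There the
    positions [p] and [p.+1] are computed directly, and the earlier ones follow from the
    cosimplicial identity. *)
Lemma missed_swap (v w : nat -> nat) (n p : nat) : (p.+1 < n)%N ->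
    (v p < v p.+1)%N -> w p = (v p.+1).-1 -> w p.+1 = v p ->
    (forall j, (j < n)%N -> j != p -> j != p.+1 -> w j = v j) ->
  forall j, (j < n)%N -> missed w n j = missed v n (swapn p j).
Proof.
move=> + lt_v wp wp1; elim: n => [|n IH] //.
rewrite ltnS leq_eqVlt => /predU1P[<- {IH}|lt_pn] wE j lt_j.
  have low m : (m <= p)%N -> forall i, missed w m i = missed v m i.
    by elim: m => [|m IHm] //= lt_mp i; rewrite wE ?IHm //; lia.
  rewrite /swapn /= wp wp1.
  case: (ltngtP j p) => [lt_jp|gt_jp|->].
  - have lt_jp1 : (j < p.+1)%N := ltnW lt_jp.
    by rewrite !(ltn_eqF lt_jp1, ltn_eqF lt_jp) low // (bump_bump _ lt_v).
  - by rewrite (_ : j = p.+1) ?eqxx ?(ltn_eqF (ltnSn p)) /bump; lia.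
  - by rewrite (ltn_eqF (ltnSn p)) eqxx /bump; lia.
have lt_p : (p < n)%N := ltnW lt_pn.
rewrite /=; have [->|nj] := eqVneq j n.
  by rewrite /swapn !(gtn_eqF lt_pn, gtn_eqF lt_p) eqxx wE // gtn_eqF.
rewrite IH //; [|by move=> i lt_i; apply/wE/ltnW|lia..].
rewrite wE; [|lia..].
have lt_t : (swapn p j < n)%N by rewrite /swapn; do 2?[case: eqP => ?]; lia.
by rewrite (ltn_eqF lt_t).
Qed.

(** * Adjacent transpositions generate the symmetric group *)

(* Products of permutations are read from left to right: [adj p * s] exchanges
   two positions of [s], and [s * adj p] exchanges two values. *)
Definition adj (k : nat) (p : 'I_k) : 'S_k.+1 := tperm (pos0 p) (pos1 p).

Lemma pos0_neq_pos1 (k : nat) (p : 'I_k) : pos0 p != pos1 p.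
Proof. by rewrite -val_eqE /= /bump /= add1n ltn_eqF. Qed.

Lemma adj_inj (k : nat) : injective (@adj k).
Proof.
move=> p q /permP eq_pq; apply/val_inj.
have := eq_pq (pos0 p); rewrite tpermL => /(congr1 val).
rewrite permE /= -!val_eqE /= /bump /= !add1n.
by do 2?case: eqP => ? /=; lia.
Qed.

Lemma adj_neq1 (k : nat) (p : 'I_k) : adj p != 1%g.
Proof.
apply/eqP => /permP/(_ (pos0 p)); rewrite tpermL perm1 => /esym/eqP.
by rewrite (negPf (pos0_neq_pos1 p)).
Qed.

Lemma adj_ind (k : nat) (P : 'S_k.+1 -> Prop) :
  P 1%g -> (forall p s, P s -> P (adj p * s)%g) -> forall s, P s.
Proof.
move=> P1 PM s.
(* Left multipliers preserving [P] are closed under products, hence form a subgroup because the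
   group is finite. *)
pose H := [set t : 'S_k.+1 | `[< forall s, P s -> P (t * s)%g >]]%SET.
have groupH : group_set H.
  apply/group_setP; split=> [|a b]; rewrite !inE.
    by apply/asboolP => t; rewrite mul1g.
  move=> /asboolP Ha /asboolP Hb; apply/asboolP => t Pt.
  by rewrite -mulgA; apply/Ha/Hb.
pose K := Group groupH.
have Kadj p : adj p \in K by rewrite inE; apply/asboolP => t; apply: PM.
have Ktp (d : nat) (i j : 'I_k.+1) : (i + d)%N = j -> tperm i j \in K.
  elim: d j => [|d IH] j eq_ij.
    by rewrite (_ : i = j) ?tperm1 ?group1 //; apply: val_inj => /=; rewrite -eq_ij addn0.
  have lt_p : (i + d < k)%N by have := ltn_ord j; lia.
  pose p := Ordinal lt_p.
  have j1 : j = pos1 p by apply: val_inj; rewrite /= /bump /=; lia.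
  have [d0|d_gt0] := posnP d.
    by rewrite j1 (_ : i = pos0 p) ?Kadj //; apply: val_inj => /=; rewrite d0 addn0.
  have ni : i != pos0 p by rewrite -val_eqE /=; lia.
  have nj : pos1 p != i by rewrite -val_eqE /= /bump /=; lia.
  (* Conjugation by [adj p] increases the distance between the two exchanged points by one. *)
  have -> : tperm i j = (tperm i (pos0 p) ^ adj p)%g.
    by rewrite tpermJ tpermL j1 tpermD // eq_sym.
  by rewrite groupJ ?Kadj ?IH.
have [ts -> _] := prod_tpermP s.
have Kt i j : tperm i j \in K.
  case: (leqP i j) => [|/ltnW] le_ij; last rewrite tpermC.
    by apply: (Ktp (j - i)%N); rewrite subnKC.
  by apply: (Ktp (i - j)%N); rewrite subnKC.
have : (\prod_(t <- ts) tperm t.1 t.2)%g \in K by apply: group_prod => t _.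
by rewrite inE => /asboolP/(_ _ P1); rewrite mulg1.
Qed.

Lemma set2_eq (T : Type) (a b c d : T) :
  [set a; b] = [set c; d] -> a = c /\ b = d \/ a = d /\ b = c.
Proof.
move=> /predeqP eq_ab_cd.
have /(_ (or_introl erefl)) ha := (eq_ab_cd a).1.
have /(_ (or_intror erefl)) hb := (eq_ab_cd b).1.
have /(_ (or_introl erefl)) hc := (eq_ab_cd c).2.
have /(_ (or_intror erefl)) hd := (eq_ab_cd d).2.
by case: ha hb hc hd => /= -> [] /= -> [] /= ? [] /= ?; subst; auto.
Qed.

(** * Connected components of the coherer graph *)

(** Only positions up to [k] are read, so the default value of [inord] never matters. *)
Definition missed_ffun (k : nat) (v : {ffun 'I_k.+1 -> nat}) (j : 'I_k.+1) : nat :=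
  missed (fun i => v (inord i)) k.+1 j.

Lemma missed_ffun_inj (k : nat) (v : {ffun 'I_k.+1 -> nat}) :
  injective (missed_ffun v).
Proof. by move=> i j /missed_inj eq_ij; apply/val_inj/eq_ij; rewrite inE. Qed.

Lemma missed_ffun_recover (k : nat) (v w : {ffun 'I_k.+1 -> nat}) :
  missed_ffun v =1 missed_ffun w -> v = w.
Proof.
move=> eq_vw; apply/ffunP => j.
rewrite -(inord_val j).
apply: (@missed_recover (fun i => v (inord i)) (fun i => w (inord i)) k.+1 _ j) => // i lt_i.
exact: eq_vw (Ordinal lt_i).
Qed.

Lemma val_pos1 (k : nat) (p : 'I_k) : pos1 p = p.+1 :> nat.
Proof. by rewrite /= /bump leq0n. Qed.

Lemma inord_pos0 (k : nat) (p : 'I_k) : inord p = pos0 p.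
Proof. by rewrite -[RHS]inord_val. Qed.

Lemma inord_pos1 (k : nat) (p : 'I_k) : inord p.+1 = pos1 p.
Proof. by rewrite -val_pos1 inord_val. Qed.

Lemma missed_ffun_ltn (k : nat) (v : {ffun 'I_k.+1 -> nat}) (p : 'I_k) :
  (missed_ffun v (pos0 p) < missed_ffun v (pos1 p))%N = (v (pos0 p) < v (pos1 p))%N.
Proof.
rewrite /missed_ffun val_pos1.
have := @missed_ltn (fun i => v (inord i)) k.+1 p (ltn_ord p).
by rewrite inord_pos0 inord_pos1.
Qed.

Lemma missed_ffun_target (k : nat) (v : {ffun 'I_k.+1 -> nat}) (p : 'I_k) :
  (v (pos0 p) < v (pos1 p))%N ->
  forall j, missed_ffun (coherer_target v p) j = missed_ffun v (adj p j).
Proof.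
move=> lt_v j.
rewrite /missed_ffun (@missed_swap (fun i => v (inord i)) _ _ p) //.
- congr missed; rewrite permE /= -!val_eqE /= [bump 0 p]val_pos1 /swapn.
  by do 2?[case: eqP => _]; rewrite ?val_pos1.
- exact: ltn_ord p.
- by rewrite inord_pos0 inord_pos1.
- by rewrite inord_pos0 inord_pos1 ffunE eqxx.
- by rewrite inord_pos0 inord_pos1 ffunE eq_sym (negPf (pos0_neq_pos1 p)) eqxx.
- move=> i lt_i ni0 ni1; rewrite ffunE -!val_eqE /= inordK // [bump 0 p]val_pos1.
  by rewrite (negPf ni0) (negPf ni1).
Qed.

Lemma adjK (k : nat) (p : 'I_k) : involutive (adj p).
Proof. exact: tpermK. Qed.

Lemma coherer_target_word (s k : nat) (v : {ffun 'I_k.+1 -> nat}) (p : 'I_k) :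
  coface_word s k v -> coface_word s k (coherer_target v p).
Proof.
move=> word_v j; rewrite ffunE; case: eqP => [->|_].
  by have := word_v (pos1 p); rewrite val_pos1 /=; lia.
case: eqP => [->|_ //].
by have := word_v (pos0 p); rewrite val_pos1 /=; lia.
Qed.

(** Inverse of a coherer: [w] has [v (pos1 p)] at [p] and [v (pos0 p) + 1] at [p + 1]. Hence at
    every [p] a word is the source or the target of a coherer. *)
Lemma coherer_source (s k : nat) (v : {ffun 'I_k.+1 -> nat}) (p : 'I_k) :
    coface_word s k v -> (v (pos1 p) <= v (pos0 p))%N ->
  exists w, [/\ coface_word s k w, (w (pos0 p) < w (pos1 p))%N &
                coherer_target w p = v].
Proof.
move=> word_v le_v.
have n10 : (pos1 p == pos0 p) = false by rewrite eq_sym (negPf (pos0_neq_pos1 p)).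
exists [ffun j => if j == pos0 p then v (pos1 p)
                  else if j == pos1 p then (v (pos0 p)).+1 else v j].
split.
- move=> j; rewrite ffunE; case: eqP => [->|_].
    by have := word_v (pos0 p); move: le_v => /=; lia.
  case: eqP => [->|_ //].
  by have := word_v (pos0 p); rewrite val_pos1 /=; lia.
- by rewrite !ffunE !eqxx n10.
- apply/ffunP => j; rewrite !ffunE !eqxx n10 /=.
  by case: eqP => [->//|_]; case: eqP => [->|].
Qed.

Lemma adjacent_word (s k : nat) (u w : {ffun 'I_k.+1 -> nat}) :
    adjacent (coherer_graph s k) u w ->
  [/\ coface_word s k u, coface_word s k w &
      exists p : 'I_k, missed_ffun w =1 missed_ffun u \o adj p].
Proof.
move=> [[e p] [/= word_e lt_e] eq_ends].
have [[<- <-]|[<- <-]] : e = u /\ coherer_target e p = w \/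
    e = w /\ coherer_target e p = u by apply: set2_eq eq_ends.
  by split=> //; [exact: coherer_target_word | exists p; exact: missed_ffun_target].
split=> //; [exact: coherer_target_word|].
by exists p => j; rewrite /= missed_ffun_target // adjK.
Qed.

Lemma adjacent_ex (s k : nat) (u : {ffun 'I_k.+1 -> nat}) (p : 'I_k) :
    coface_word s k u ->
  exists2 w, adjacent (coherer_graph s k) u w &
             missed_ffun w =1 missed_ffun u \o adj p.
Proof.
move=> word_u; have [lt_u|le_u] := ltnP (u (pos0 p)) (u (pos1 p)).
  exists (coherer_target u p); last exact: missed_ffun_target.
  by exists (u, p).
have [w [word_w lt_w <-]] := coherer_source word_u le_u.
exists w; first by exists (w, p) => //=; rewrite setUC.
by move=> j; rewrite /= missed_ffun_target // adjK.
Qed.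

Lemma reach_perm (s k : nat) (v w : {ffun 'I_k.+1 -> nat}) :
    coface_word s k v ->
    clos_refl_trans _ (adjacent (coherer_graph s k)) v w ->
  coface_word s k w /\
  exists t : 'S_k.+1, missed_ffun w =1 missed_ffun v \o t.
Proof.
move=> + reach; elim: reach => {v w} [u w /adjacent_word[_ word_w [p eq_w]] _|u|].
- by split=> //; exists (adj p).
- by move=> word_u; split=> //; exists 1%g => j; rewrite /= perm1.
move=> u1 u2 u3 _ IH1 _ IH2 /IH1[word_u2 [t1 eq1]].
have [word_u3 [t2 eq2]] := IH2 word_u2.
(* Positions are permuted, so the later part of the path acts first. *)
by split=> //; exists (t2 * t1)%g => j; rewrite /= permM eq2 /= eq1.
Qed.

Lemma reach_ex (s k : nat) (v : {ffun 'I_k.+1 -> nat}) (t : 'S_k.+1) :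
    coface_word s k v ->
  exists2 w, clos_refl_trans _ (adjacent (coherer_graph s k)) v w &
             missed_ffun w =1 missed_ffun v \o t.
Proof.
move=> word_v; elim/adj_ind: t => [|p t [u reach_u eq_u]].
  by exists v => [|j]; [exact: rt_refl | rewrite /= perm1].
have [word_u _] := reach_perm word_v reach_u.
have [w adj_w eq_w] := adjacent_ex p word_u.
exists w => [|j]; last by rewrite eq_w /= eq_u /= permM.
by apply: rt_trans reach_u _; apply: rt_step.
Qed.

(** * Convex hulls and their faces *)

Section Hull.
Variables (R : realType) (E : vectType R).
Implicit Types (A D : set E) (l : {scalar E}).

Lemma convex_setP D : @convex_set R (convex_lmodType E) D <->
    forall (a b : E) (t : R), 0 < t -> t < 1 -> D a -> D b ->
      D (t *: a + (1 - t) *: b).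
Proof.
split=> [convD a b t t0 t1 Da Db|convD].
  exact/set_mem/(convD a b (Itv01 (ltW t0) (ltW t1)) (mem_set Da) (mem_set Db)).
apply/convex_setW => a b; rewrite !inE => Da Db t t0 t1.
by rewrite inE; apply: convD.
Qed.

Lemma convex_hull_convex A : @convex_set R (convex_lmodType E) (convex_hull A).
Proof.
move=> a b t; rewrite !inE => Ha Hb D [convD AD].
exact/set_mem/(convD a b t (mem_set (Ha D (conj convD AD)))
                           (mem_set (Hb D (conj convD AD)))).
Qed.

Lemma sub_convex_hull A : A `<=` convex_hull A.
Proof. by move=> a Aa D [_]; apply. Qed.

Lemma convex_hull_min A D :
  @convex_set R (convex_lmodType E) D -> A `<=` D -> convex_hull A `<=` D.
Proof. by move=> convD AD a; apply. Qed.

Lemma le_convex_hull A l (c : R) :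
  (forall a, A a -> l a <= c) -> forall x, convex_hull A x -> l x <= c.
Proof.
move=> le_l; apply: (@convex_hull_min A [set x | l x <= c]) => //.
apply/convex_setP => a b t t0 t1 /= la lb.
rewrite linearD !linearZ /=; nra.
Qed.

(** A convex combination with both weights positive reaches the maximum [c] only if both of its
    points do. *)
Lemma convex_hull_face A l (c : R) : (forall a, A a -> l a <= c) ->
  convex_hull A `&` [set x | l x = c] = convex_hull (A `&` [set x | l x = c]).
Proof.
move=> le_l; set B := A `&` _; apply/seteqP; split=> x.
  (* The implication is put into the set so that minimality of the hull applies to it. *)
  suff : convex_hull A `<=` [set x | l x <= c /\ (l x = c -> convex_hull B x)].
    by move=> sub_A [/sub_A[_ hull_x] /hull_x].
  apply: convex_hull_min => [|a Aa].
    apply/convex_setP => a b t t0 t1 /= [la ha] [lb hb].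
    rewrite linearD !linearZ /=; split; first nra.
    move=> l_ab; have la_c : l a = c by nra.
    have lb_c : l b = c by nra.
    have convB := (convex_setP _).1 (@convex_hull_convex B).
    exact: convB t0 t1 (ha la_c) (hb lb_c).
  by split=> [|la]; [exact: le_l | apply: sub_convex_hull].
move=> hull_x; split.
  by apply: convex_hull_min hull_x; [exact: convex_hull_convex | move=> a [/sub_convex_hull]].
apply: (@convex_hull_min B [set x | l x = c]) hull_x => [|a []//].
apply/convex_setP => a b t t0 t1 /= la lb.
by rewrite linearD !linearZ /= la lb; ring.
Qed.

End Hull.

(** * Linear forms maximised at one or two permutations *)

Section Permutohedron.
Variables (R : realType) (k : nat).
Local Notation E := 'rV[R]_k.+1.
Implicit Types (r s t : 'S_k.+1) (u x : E).

Definition dot u x : R := \sum_j u 0 j * x 0 j.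

Fact dot_is_scalar u : scalar (dot u).
Proof.
move=> a x y; rewrite /dot mulr_sumr -big_split /=; apply: eq_bigr => j _.
by rewrite !mxE mulrDr mulrCA.
Qed.

HB.instance Definition _ u := GRing.isLinear.Build R E R _ (dot u) (dot_is_scalar u).

Definition perm_pt s : E := \row_j (s j).+1%:R.

Lemma perm_pt_inj : injective perm_pt.
Proof.
move=> s t /rowP eq_st; apply/permP => j; apply: val_inj.
by have /eqP := eq_st j; rewrite !mxE eqr_nat eqSS => /eqP.
Qed.

Lemma dot_perm_pt s t : dot (perm_pt s) (perm_pt s) = dot (perm_pt t) (perm_pt t).
Proof.
rewrite /dot (reindex_inj (@perm_inj _ s^-1%g)) [RHS](reindex_inj (@perm_inj _ t^-1%g)).
by apply: eq_bigr => j _; rewrite !mxE !permKV.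
Qed.

(** Treats together [t = s], which gives the vertices, and [t = s * adj p], which gives the
    edges. *)
Definition close_perms s t := forall j, (s j <= (t j).+1)%N && (t j <= (s j).+1)%N.

(* The points [perm_pt r] all have the same norm, so that [(r - s) . (r - t)] is
   affine in [r]. *)
Lemma perm_gap r s t :
  \sum_j ((r j)%:R - (s j)%:R) * ((r j)%:R - (t j)%:R) =
  dot (perm_pt s) (perm_pt s) + dot (perm_pt s) (perm_pt t) -
  dot (perm_pt s + perm_pt t) (perm_pt r).
Proof.
rewrite (dot_perm_pt s r) /dot -big_split /= -sumrB.
by apply: eq_bigr => j _; rewrite !mxE !mulrSr; ring.
Qed.

(** No integer lies strictly between [s j] and [t j], so the two factors never have opposite
    signs. *)
Lemma close_term_ge0 r s t j : close_perms s t ->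
  0 <= ((r j)%:R - (s j)%:R) * ((r j)%:R - (t j)%:R) :> R.
Proof.
move=> /(_ j) /andP[]; move: (r j : nat) (s j : nat) (t j : nat) => a b c bc cb.
have [le_ab|lt_ba] := leqP a (minn b c).
  by apply: mulr_le0; rewrite subr_le0 ler_nat; lia.
have [le_ba|lt_ab] := leqP (maxn b c) a.
  by apply: mulr_ge0; rewrite subr_ge0 ler_nat; lia.
lia.
Qed.

Lemma close_perms_le r s t : close_perms s t ->
  dot (perm_pt s + perm_pt t) (perm_pt r) <=
  dot (perm_pt s) (perm_pt s) + dot (perm_pt s) (perm_pt t).
Proof.
move=> st; rewrite -subr_ge0 -perm_gap.
by apply: sumr_ge0 => j _; apply: close_term_ge0.
Qed.

Lemma close_perms_eq r s t : close_perms s t ->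
    dot (perm_pt s + perm_pt t) (perm_pt r) =
    dot (perm_pt s) (perm_pt s) + dot (perm_pt s) (perm_pt t) ->
  forall j, r j = s j \/ r j = t j.
Proof.
move=> st /esym/eqP; rewrite -subr_eq0 -perm_gap psumr_eq0; last first.
  by move=> j _; apply: close_term_ge0.
move=> /allP eq0 j; have := eq0 j (mem_index_enum j).
by rewrite mulf_eq0 !subr_eq0 !eqr_nat => /orP[]/eqP/val_inj; auto.
Qed.

Lemma close_perms_attained s t :
  dot (perm_pt s + perm_pt t) (perm_pt s) =
  dot (perm_pt s) (perm_pt s) + dot (perm_pt s) (perm_pt t).
Proof.
apply/esym/eqP; rewrite -subr_eq0 -perm_gap big1 // => j _.
by rewrite subrr mul0r.
Qed.

Lemma close_perms_refl s : close_perms s s.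
Proof. by move=> j; lia. Qed.

Lemma close_perms_adj s p : close_perms s (s * adj p).
Proof.
move=> j; rewrite permM permE /=.
case: eqP => [->|_]; first by rewrite val_pos1 /=; lia.
case: eqP => [->|_]; last lia.
by rewrite val_pos1 /=; lia.
Qed.

(** The two candidates differ only at the positions [i0] and [i1], where they exchange two values. A
    mixed choice would make [r] take one value twice. *)
Lemma adj_pointwise r s p :
  (forall j, r j = s j \/ r j = (s * adj p)%g j) -> r = s \/ r = (s * adj p)%g.
Proof.
move=> rE; pose i0 := (s^-1)%g (pos0 p); pose i1 := (s^-1)%g (pos1 p).
have s0 : s i0 = pos0 p by rewrite permKV.
have s1 : s i1 = pos1 p by rewrite permKV.
have n01 : i0 != i1 by rewrite (inj_eq perm_inj) pos0_neq_pos1.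
have rD j : j != i0 -> j != i1 -> r j = s j /\ r j = (s * adj p)%g j.
  move=> n0 n1; have := rE j; rewrite permM tpermD.
    by case=> ->.
  - by rewrite -s0 (inj_eq perm_inj) eq_sym.
  - by rewrite -s1 (inj_eq perm_inj) eq_sym.
have t0 : (s * adj p)%g i0 = pos1 p by rewrite permM s0 tpermL.
have t1 : (s * adj p)%g i1 = pos0 p by rewrite permM s1 tpermR.
have : r i0 != r i1 by rewrite (inj_eq perm_inj).
have := rE i0; have := rE i1; rewrite s0 s1 t0 t1.
case=> r1; case=> r0; rewrite r0 r1 ?eqxx // => _; [left|right]; apply/permP => j.
all: have [->|n0] := eqVneq j i0; first by rewrite r0 ?s0 ?t0.
all: have [->|n1] := eqVneq j i1; first by rewrite r1 ?s1 ?t1.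
all: by case: (rD j n0 n1).
Qed.

End Permutohedron.
(** Counting strict increases from position 0 gives [j <= s j]; counting them up to position [k]
    gives [s j <= j]. *)
Lemma perm_increasing (k : nat) (s : 'S_k.+1) :
  (forall p : 'I_k, (s (pos0 p) < s (pos1 p))%N) -> s = 1%g.
Proof.
move=> incr.
have gap (d : nat) (i j : 'I_k.+1) : (i + d)%N = j -> (s i + d <= s j)%N.
  elim: d j => [|d IH] j eq_ij.
    by rewrite addn0 (_ : i = j) //; apply: val_inj; rewrite /= -eq_ij addn0.
  have lt_p : (i + d < k)%N by have := ltn_ord j; lia.
  have := incr (Ordinal lt_p).
  have -> : pos1 (Ordinal lt_p) = j by apply: val_inj; rewrite /= /bump /=; lia.
  by have := IH (pos0 (Ordinal lt_p)) erefl; lia.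
apply/permP => j; rewrite perm1; apply/val_inj.
have := gap j ord0 j (add0n _).
have := gap (k - j)%N j ord_max (subnKC (leq_ord j)).
have := leq_ord (s ord_max); have := leq_ord j => /=; lia.
Qed.

(** The product [s^-1 * t] lists the values of [t] in the order of the values of [s]; without a
    descent it would be the identity. *)
Lemma perm_descent (k : nat) (s t : 'S_k.+1) : s <> t ->
  exists p : 'I_k, (t ((s^-1)%g (pos1 p)) < t ((s^-1)%g (pos0 p)))%N.
Proof.
move=> neq_st; apply: contrapT => no_descent; apply: neq_st.
have /(congr1 (fun r => s * r)%g) : (s^-1 * t)%g = 1%g; last by rewrite mulKVg mulg1.
apply: perm_increasing => p; rewrite !permM ltn_neqAle.
rewrite (inj_eq val_inj) (inj_eq perm_inj) (inj_eq perm_inj) pos0_neq_pos1 /= leqNgt.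
by apply/negP => lt_t; apply: no_descent; exists p.
Qed.

(** * Vertices and edges of the permutohedron *)

Section Faces.
Variables (R : realType) (k : nat).
Local Notation E := 'rV[R]_k.+1.
Local Notation P := (permutohedron R k).
Local Notation perm_pt := (@perm_pt R k).
Implicit Types (r s t : 'S_k.+1) (u x : E) (l : {scalar E}).

Lemma face_permutohedron l (c : R) : (forall x, P x -> l x <= c) ->
  P `&` [set x | l x = c] = convex_hull (range perm_pt `&` [set x | l x = c]).
Proof. by move=> le_l; apply: convex_hull_face => a /sub_convex_hull/le_l. Qed.

Lemma vertices_permutohedron : polytope_vertex P = range perm_pt.
Proof.
apply/seteqP; split=> x.
  move=> [l [c [le_l eq_x]]].
  rewrite (face_permutohedron le_l) in eq_x.
  have : convex_hull (range perm_pt `&` [set x | l x = c]) x by rewrite -eq_x.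
  move=> hull_x; apply: contrapT => no_s.
  (* If [x] is no permutation point, its face contains none, so [x] would lie in the hull of the
     empty set. *)
  apply: (@convex_hull_min _ _ _ set0 _ _ x hull_x).
    by apply/convex_setP.
  move=> a A; have : [set x] a by rewrite eq_x; apply: sub_convex_hull.
  by move=> eq_a; apply: no_s; rewrite -eq_a; case: A.
move=> [s _ <-].
pose c := dot (perm_pt s) (perm_pt s) + dot (perm_pt s) (perm_pt s).
have le_c y : P y -> dot (perm_pt s + perm_pt s) y <= c.
  apply: le_convex_hull => _ [r _ <-].
  exact/close_perms_le/close_perms_refl.
exists (dot (perm_pt s + perm_pt s)), c; split=> //.
rewrite (face_permutohedron le_c).
apply/seteqP; split=> [_ ->|].
  apply: sub_convex_hull; split; first by exists s.
  exact: close_perms_attained.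
apply: convex_hull_min.
  by apply/convex_setP => a b t _ _ -> ->; rewrite /= -scalerDl subrKC scale1r.
move=> _ [[r _ <-] /close_perms_eq eq_r] /=; congr perm_pt.
by apply/permP => j; case: (eq_r (@close_perms_refl _ s) j).
Qed.

Definition perm_edge s (p : 'I_k) : set E :=
  convex_hull [set perm_pt s; perm_pt (s * adj p)%g].

Lemma perm_edgeE s p (t := (s * adj p)%g) :
  perm_edge s p = P `&` [set x | dot (perm_pt s + perm_pt t) x =
                    dot (perm_pt s) (perm_pt s) + dot (perm_pt s) (perm_pt t)].
Proof.
rewrite face_permutohedron; last first.
  apply: le_convex_hull => _ [r _ <-]; exact/close_perms_le/close_perms_adj.
congr convex_hull; apply/seteqP; split=> x.
  case=> ->; split; [by exists s| |by exists t|].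
    exact: close_perms_attained.
  (* Exchanging [s] and [t] gives the value at [t]; equality of the norms identifies it with the
     constant. *)
  rewrite /= addrC close_perms_attained (dot_perm_pt _ t s) /dot.
  by congr (_ + _); apply: eq_bigr => j _; rewrite mulrC.
move=> [[r _ <-] dot_r].
by case/adj_pointwise: (close_perms_eq (@close_perms_adj _ s p) dot_r) => ->; [left|right].
Qed.

Lemma face_perm_edge s p : face P (perm_edge s p).
Proof.
pose t := (s * adj p)%g.
exists (dot (perm_pt s + perm_pt t)).
exists (dot (perm_pt s) (perm_pt s) + dot (perm_pt s) (perm_pt t)).
split; last exact: perm_edgeE.
apply: le_convex_hull => _ [r _ <-]; exact/close_perms_le/close_perms_adj.
Qed.

Lemma ends_perm_edge s p :
  perm_edge s p `&` polytope_vertex P = [set perm_pt s; perm_pt (s * adj p)%g].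
Proof.
rewrite vertices_permutohedron; apply/seteqP; split=> x.
  rewrite perm_edgeE => -[[_ dot_x] [r _ eq_x]]; rewrite -eq_x in dot_x *.
  have /adj_pointwise[->|->] := close_perms_eq (@close_perms_adj _ s p) dot_x; by [left|right].
by move=> x_st; split; [exact: sub_convex_hull | case: x_st => ->; eexists].
Qed.

Lemma convex_coset (x0 : E) (U : {vspace E}) :
  @convex_set R (convex_lmodType E) [set x | x - x0 \in U].
Proof.
apply/convex_setP => a b t _ _ /= aU bU.
have -> : t *: a + (1 - t) *: b - x0 = t *: (a - x0) + (1 - t) *: (b - x0).
  by rewrite !scalerBr addrACA -opprD -scalerDl subrKC scale1r.
by rewrite rpredD // rpredZ.
Qed.

Lemma dim_perm_edge s p : has_affine_dim (perm_edge s p) 1%N.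
Proof.
pose d := perm_pt (s * adj p)%g - perm_pt s.
have sub_edge : [set perm_pt s; perm_pt (s * adj p)%g] `<=` perm_edge s p.
  exact: sub_convex_hull.
exists (perm_pt s), <[d]>%VS; split.
- by apply: sub_edge; left.
- rewrite dim_vline subr_eq0 (inj_eq (@perm_pt_inj _ _)) -[X in _ == X]mulg1.
  by rewrite (inj_eq (mulgI s)) adj_neq1.
- apply: convex_hull_min; first exact: convex_coset.
  by move=> x [] ->; rewrite /= ?subrr ?mem0v ?memv_line.
- move=> W /(_ (perm_pt (s * adj p)%g)) subW.
  by rewrite -memvE; apply: subW; apply: sub_edge; right.
Qed.

Lemma dotD_scale u x (a : R) :
  dot (u + a *: x) (u + a *: x) = dot u u + 2 * a * dot u x + a ^+ 2 * dot x x.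
Proof.
rewrite /dot !mulr_sumr -!big_split /=; apply: eq_bigr => j _.
by rewrite !mxE; ring.
Qed.

Lemma dot_eq0 u : dot u u = 0 -> u = 0.
Proof.
move/eqP; rewrite psumr_eq0 => [/allP eq0|j _]; last by rewrite -expr2 sqr_ge0.
apply/rowP => j; rewrite mxE.
by have := eq0 j (mem_index_enum j); rewrite mulf_eq0 orbb => /eqP.
Qed.

(* A line meets a sphere in at most two points. *)
Lemma perm_pt_line r s t (x0 : E) (U : {vspace E}) : \dim U = 1%N ->
    perm_pt r - x0 \in U -> perm_pt s - x0 \in U -> perm_pt t - x0 \in U ->
  s <> t -> r = s \/ r = t.
Proof.
move=> dimU rU sU tU neq_st; pose d := perm_pt t - perm_pt s.
have sub_x0 x y : x - x0 \in U -> y - x0 \in U -> x - y \in U.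
  by move=> xU yU; rewrite -(subrKA x0) addrC -opprB rpredD ?rpredN //; rewrite -opprB rpredN.
have d_neq0 : d != 0 by rewrite subr_eq0; apply/eqP => /perm_pt_inj/esym.
(* The nonzero [d] lies in [U], which is a line. *)
have eqU : <[d]>%VS = U.
  by apply/eqP; rewrite eqEdim -memvE sub_x0 // dim_vline d_neq0 dimU.
have /vlineP[a eq_a] : perm_pt r - perm_pt s \in <[d]>%VS by rewrite eqU sub_x0.
have eq_r : perm_pt r = perm_pt s + a *: d by rewrite -eq_a subrKC.
have eq_t : perm_pt t = perm_pt s + 1 *: d by rewrite scale1r subrKC.
have norm_r := dot_perm_pt R r s; have norm_t := dot_perm_pt R t s.
rewrite eq_r dotD_scale in norm_r; rewrite eq_t dotD_scale in norm_t.
have dd_neq0 : dot d d != 0 by apply: contraNneq d_neq0 => /dot_eq0 ->.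
(* Equal norms of [s + a d] and [s] give [2 a (s . d) + a^2 (d . d) = 0]. The case [a = 1], for [t],
   determines [s . d], and then [a (a - 1) (d . d) = 0]. *)
have dot_sd : 2 * dot (perm_pt s) d = - dot d d by lra.
have : a * (a - 1) * dot d d = a * (2 * dot (perm_pt s) d) + a ^+ 2 * dot d d.
  by rewrite dot_sd; ring.
rewrite [RHS](_ : _ = 0); last lra.
move=> /eqP; rewrite !mulf_eq0 (negPf dd_neq0) orbF subr_eq0 => /orP[]/eqP a_eq.
  by left; apply/(@perm_pt_inj R); rewrite eq_r a_eq scale0r addr0.
by right; apply/(@perm_pt_inj R); rewrite eq_r a_eq -eq_t.
Qed.

(** Only the coordinates [i] and [j] change, by opposite amounts, so the displacement is a multiple
    of a root of type A. *)
Lemma perm_pt_tperm r (i j : 'I_k.+1) :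
  perm_pt r - perm_pt (tperm i j * r)%g =
  ((r i)%:R - (r j)%:R) *: (delta_mx 0 i - delta_mx 0 j).
Proof.
apply/rowP => m; rewrite !mxE eqxx /= permM permE /=.
have [->|ni] := eqVneq m i; first by have [->|nj] := eqVneq i j; rewrite /= ?mulrSr; ring.
have [->|nj] := eqVneq m j; first by rewrite /= !mulrSr; ring.
by rewrite subrr !subr0 mulr0.
Qed.

(* The difference of the coefficients of [l] at the two positions that carry
   the values [p] and [p + 1] of [s] has one sign because [s] is maximal, and the
   other because [t] is. *)
Lemma maximal_adj l (c : R) s t : (forall r, l (perm_pt r) <= c) ->
    l (perm_pt s) = c -> l (perm_pt t) = c -> s <> t ->
  exists p, l (perm_pt (s * adj p)%g) = c.
Proof.
move=> le_l ls lt /perm_descent[p]; set j := (s^-1)%g _; set i := (s^-1)%g _ => lt_t.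
have s_i : s i = pos0 p by rewrite permKV.
have s_j : s j = pos1 p by rewrite permKV.
(* The exchange of values becomes one of positions, whose effect on [l] does not depend on the
   permutation except through a scalar. *)
have eq_adj : (s * adj p)%g = (tperm i j * s)%g.
  by rewrite /adj -s_i -s_j -tpermJ conjgE mulKVg.
pose e : R := l (delta_mx 0 i - delta_mx 0 j).
have l_tperm r : l (perm_pt (tperm i j * r)%g) = l (perm_pt r) - ((r i)%:R - (r j)%:R) * e.
  rewrite -[in RHS](subrK (perm_pt (tperm i j * r)%g) (perm_pt r)).
  by rewrite perm_pt_tperm linearD linearZ /= addrC addKr.
have := le_l (tperm i j * s)%g; have := le_l (tperm i j * t)%g.
rewrite !l_tperm ls lt s_i s_j val_pos1 /= mulrSr => le_t le_s.
have t_gt0 : (0 : R) < (t i)%:R - (t j)%:R by rewrite subr_gt0 ltr_nat.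
have e_eq0 : e = 0 by nra.
by exists p; rewrite eq_adj l_tperm ls e_eq0 mulr0 subr0.
Qed.

Lemma edge_permutohedron (F : set E) : face P F -> has_affine_dim F 1%N ->
  exists s p, F = perm_edge s p.
Proof.
move=> [l [c [le_l eq_F]]] [x0 [U [F_x0 dimU sub_U min_U]]].
have F_hull : F = convex_hull (range perm_pt `&` [set x | l x = c]).
  by rewrite eq_F face_permutohedron.
have le_pt r : l (perm_pt r) <= c by apply: le_l; apply: sub_convex_hull; exists r.
have F_pt r : l (perm_pt r) = c -> F (perm_pt r).
  by move=> lr; rewrite F_hull; apply: sub_convex_hull; split=> //; exists r.
have [s ls] : exists s, l (perm_pt s) = c.
  apply: contrapT => no_s; move: F_x0; rewrite F_hull => hull_x0.
  apply: (@convex_hull_min _ _ _ set0 _ _ x0 hull_x0); first by apply/convex_setP.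
  by move=> a [[r _ eq_a] la]; apply: no_s; exists r; rewrite eq_a.
(* With [s] as the only maximiser, [F] would be a single point and [U] would be zero. *)
have [t [neq_st lt]] : exists t, s <> t /\ l (perm_pt t) = c.
  apply: contrapT => no_t.
  have F_s x : F x -> x - perm_pt s \in 0%VS.
    rewrite F_hull; apply: (@convex_hull_min _ _ _ [set y | y - perm_pt s \in 0%VS]).
      exact: convex_coset.
    move=> _ [[r _ <-] lr] /=; rewrite (_ : r = s) ?subrr ?mem0v //.
    by apply: contrapT => neq_rs; apply: no_t; exists r; split=> // /esym.
  have eq_x0 : x0 = perm_pt s.
    by apply/eqP; rewrite -subr_eq0 -memv0; apply: F_s.
  have : (U <= 0)%VS by apply: min_U => x Fx; rewrite eq_x0 F_s.
  by move=> /dimvS; rewrite dimU dimv0.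
have [p lp] := maximal_adj le_pt ls lt neq_st.
have U_pt r : l (perm_pt r) = c -> perm_pt r - x0 \in U by move=> lr; exact/sub_U/F_pt.
(* All maximisers lie on the line through [s] and [s * adj p], so there are no others. *)
exists s, p; rewrite F_hull; congr convex_hull; apply/seteqP; split=> x.
  move=> [[r _ <-] lr].
  have neq_sp : s <> (s * adj p)%g.
    by rewrite -{1}[s]mulg1 => /mulgI/esym/eqP; rewrite (negPf (adj_neq1 p)).
  by have [->|->] := perm_pt_line dimU (U_pt _ lr) (U_pt _ ls) (U_pt _ lp) neq_sp;
    [left|right].
by case=> ->; split=> //; eexists.
Qed.

End Faces.

(** * The isomorphism of graphs *)

Lemma adjV (k : nat) (p : 'I_k) : ((adj p)^-1 = adj p)%g.
Proof. exact: tpermV. Qed.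

(** A coherer is named by its source, whereas an edge of the polytope can be presented from either
    endpoint. *)
Lemma perm_edge_adj (R : realType) (k : nat) (s : 'S_k.+1) (p : 'I_k) :
  perm_edge (R := R) (s * adj p)%g p = perm_edge (R := R) s p.
Proof. by rewrite /perm_edge -mulgA [(adj p * adj p)%g]tperm2 mulg1 setUC. Qed.

Theorem corollary4p5 (R : realType) (s k : nat) (hs : (1 <= s)%N)
    (hk : (1 <= k)%N) (v : {ffun 'I_k.+1 -> nat})
    (hv : verts (coherer_graph s k) v) :
  graph_iso (component (coherer_graph s k) v)
            (one_skeleton (permutohedron R k)).
Proof.
pose G := coherer_graph s k.
pose reach := clos_refl_trans _ (adjacent G) v.
have word_v : coface_word s k v by [].
pose rearr w := [set t : 'S_k.+1 | missed_ffun w =1 missed_ffun v \o t].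
(* The default [1%g] is never taken on the component, where [rearr w] is nonempty. *)
pose sigma w : 'S_k.+1 := xget 1%g (rearr w).
have sigmaP w : reach w -> missed_ffun w =1 missed_ffun v \o sigma w.
  by move=> /(reach_perm word_v)[_ [t eq_t]]; apply: (@xgetI _ _ (rearr w) t).
have sigma_eq w (t : 'S_k.+1) : missed_ffun w =1 missed_ffun v \o t -> sigma w = t.
  move=> eq_t.
  have eq_s : missed_ffun w =1 missed_ffun v \o sigma w.
    by apply: (@xgetI _ _ (rearr w) t).
  apply/permP => j.
  by apply: (@missed_ffun_inj _ v); rewrite -[LHS]eq_s eq_t.
have sigma_inj w w' : reach w -> reach w' -> sigma w = sigma w' -> w = w'.
  move=> /sigmaP eq_w /sigmaP eq_w' eq_sigma; apply: missed_ffun_recover => j.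
  by rewrite eq_w eq_w' eq_sigma.
have sigma_target w p : reach w -> (w (pos0 p) < w (pos1 p))%N ->
    sigma (coherer_target w p) = (adj p * sigma w)%g.
  move=> /sigmaP eq_w lt_w; apply: sigma_eq => j.
  by rewrite missed_ffun_target // eq_w /= permM.
have reach_target w p : coface_word s k w -> reach w -> (w (pos0 p) < w (pos1 p))%N ->
    reach (coherer_target w p).
  by move=> word_w reach_w lt_w; apply: rt_trans reach_w _; apply: rt_step; exists (w, p).
(* A coherer multiplies [sigma w] by [adj p] on the left, an edge of the polytope multiplies on the
   right; the inverse reconciles the two. *)
pose f w : 'rV[R]_k.+1 := perm_pt R (sigma w)^-1%g.
pose g (e : {ffun 'I_k.+1 -> nat} * 'I_k) := perm_edge (R := R) (sigma e.1)^-1%g e.2.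
have edgeP e : edges (component G v) e ->
    [/\ coface_word s k e.1, (e.1 (pos0 e.2) < e.1 (pos1 e.2))%N & reach e.1].
  by move=> [[word_e lt_e] sub_e]; split=> //; apply: sub_e; left.
have ends_g e : edges (component G v) e ->
    ends (one_skeleton (permutohedron R k)) (g e) =
    [set f e.1; f (coherer_target e.1 e.2)].
  move=> /edgeP[word_e lt_e reach_e].
  by rewrite /= ends_perm_edge /f sigma_target // invMg adjV.
exists f, g; split.
- split.
  + by move=> w _; rewrite /= vertices_permutohedron; eexists.
  + move=> w w' /set_mem[_ reach_w] /set_mem[_ reach_w'] /perm_pt_inj/invg_inj.
    exact: sigma_inj.
  + move=> x; rewrite /= vertices_permutohedron => -[t _ <-].
    have [w reach_w /sigma_eq eq_w] := reach_ex (t^-1)%g word_v.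
    exists w; last by rewrite /f eq_w invgK.
    by split=> //; have [] := reach_perm word_v reach_w.
- split.
  + by move=> e _; split; [exact: face_perm_edge | exact: dim_perm_edge].
  + move=> [w p] [w' p'] /set_mem edge_e /set_mem edge_e' eq_g.
    have [/= word_w lt_w reach_w] := edgeP _ edge_e.
    have [/= word_w' lt_w' reach_w'] := edgeP _ edge_e'.
    have eq_ends : [set f w; f (coherer_target w p)] =
        [set f w'; f (coherer_target w' p')].
      by rewrite -(ends_g (w, p)) // -(ends_g (w', p')) // eq_g.
    (* Either the sources agree, or each coherer ends at the source of the other. *)
    have [[/perm_pt_inj/invg_inj eq1 /perm_pt_inj/invg_inj]|
          [/perm_pt_inj/invg_inj eq1 /perm_pt_inj/invg_inj]] := set2_eq eq_ends.
      rewrite !sigma_target // eq1 => /mulIg/adj_inj ->.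
      by rewrite (sigma_inj _ _ reach_w reach_w' eq1).
    rewrite sigma_target // => eq2.
    have eq_p : p = p'.
      apply: adj_inj; apply: (@mulIg _ (sigma w')).
      by rewrite -(sigma_target w' p') // -eq1 -eq2 mulgA [(adj p * adj p)%g]tperm2 mul1g.
    have eq_w := sigma_inj _ _ reach_w (reach_target _ _ word_w' reach_w' lt_w') eq1.
    (* The crossed case is absurd: a coherer at [p] reverses the order of the values omitted at [p]
       and [p + 1], so these would decrease in [w]. *)
    move: lt_w; rewrite -missed_ffun_ltn eq_w -eq_p !missed_ffun_target ?eq_p //.
    by rewrite tpermL tpermR ltnNge ltnW // missed_ffun_ltn.
  + move=> F [face_F /(edge_permutohedron face_F)[t [p ->]]].
    have [w reach_w eq_w] := reach_ex (t^-1)%g word_v.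
    have [word_w _] := reach_perm word_v reach_w.
    have sigma_w : sigma w = (t^-1)%g by apply: sigma_eq.
    (* The coherer at [p] touching [w] starts at [w] or ends there; in the second case its source
       [u] represents the other end of the edge. *)
    have [lt_w|le_w] := ltnP (w (pos0 p)) (w (pos1 p)).
      exists (w, p); last by rewrite /g /= sigma_w invgK.
      by split=> // u [->|->] //; apply: reach_target.
    have [u [word_u lt_u eq_u]] := coherer_source word_w le_w.
    have reach_u : reach u.
      apply: rt_trans reach_w _; apply: rt_step; exists (u, p) => //=.
      by rewrite eq_u setUC.
    have := sigma_target u p reach_u lt_u.
    rewrite eq_u sigma_w => eq_t.
    exists (u, p).
      by split=> // x [->|->] //; apply: reach_target.
    rewrite /g /= -perm_edge_adj.
    by have -> : ((sigma u)^-1 * adj p = t)%g by rewrite -[t]invgK eq_t invMg adjV.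
- move=> e edge_e; rewrite ends_g //=.
  by rewrite image_setU !image_set1.
Qed.
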